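(* Let $\mathbf{X}_t=\sum_{s=1}^p\Phi(s)\mathbf{X}_{t-s}+\varepsilon_t$ be a stationary $N$-variate Gaussian vector autoregressive process with innovation covariance matrix $\Sigma$, let $X,Y$ be components of $\mathbf{X}$, let $\tau>0$ be an integer, and suppose there is a link $X_{t-\tau}\to Y_t$ in the time series graph, with coefficient $c=\Phi_{YX}(\tau)$. Write $X,\mathbf{Z},\varepsilon_X$ for $X_{t-\tau},\mathbf{Z}_{t-\tau},\varepsilon_{X,t-\tau}$ and $Y,\mathbf{W},\varepsilon_Y$ for $Y_t,\mathbf{W}_t,\varepsilon_{Y,t}$, where $\mathbf{Z}_{t-\tau}$ is the row vector of the parents of $X_{t-\tau}$ and $\mathbf{W}_t$ is the row vector of the parents of $Y_t$ other than $X_{t-\tau}$, so that $$X=\mathbf{Z}A+\varepsilon_X,\qquad Y=cX+\mathbf{W}B+\varepsilon_Y .$$ Let $\mathbf{U}=(\mathbf{W},\mathbf{Z})$, assume that $E[\mathbf{U}^\top\mathbf{U}]$ is invertible, and let $$X_{\mathbf{U}}=X-\mathbf{U}(E[\mathbf{U}^\top\mathbf{U}])^{-1}E[\mathbf{U}^\top X],\qquad Y_{\mathbf{U}}=Y-\mathbf{U}(E[\mathbf{U}^\top\mathbf{U}])^{-1}E[\mathbf{U}^\top Y].$$ Then the covariance and variances that make up the partial correlation $$\rho^{\rm MIT}_{X\to Y}(\tau)=\frac{E[Y_{\mathbf{U}}^\top X_{\mathbf{U}}]}{\sqrt{E[Y_{\mathbf{U}}^\top Y_{\mathbf{U}}]}\sqrt{E[X_{\mathbf{U}}^\top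 X_{\mathbf{U}}]}}$$ are $$E[Y_{\mathbf{U}}^\top X_{\mathbf{U}}]=c\,\sigma_X^2-c\,E[\varepsilon_X^\top\mathbf{W}]\,S_Z^{-1}\,E[\mathbf{W}^\top\varepsilon_X],$$ $$E[Y_{\mathbf{U}}^\top Y_{\mathbf{U}}]=\sigma_Y^2+c^2\sigma_X^2-c^2E[\varepsilon_X^\top\mathbf{W}]\,S_Z^{-1}\,E[\mathbf{W}^\top\varepsilon_X],$$ $$E[X_{\mathbf{U}}^\top X_{\mathbf{U}}]=\sigma_X^2-E[\varepsilon_X^\top\mathbf{W}]\,S_Z^{-1}\,E[\mathbf{W}^\top\varepsilon_X],$$ where $S_Z$ is the Schur complement $$S_Z=E[\mathbf{W}^\top\mathbf{W}]-E[\mathbf{W}^\top\mathbf{Z}]\,(E[\mathbf{Z}^\top\mathbf{Z}])^{-1}\,E[\mathbf{Z}^\top\mathbf{W}].$$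
   Context: Process: $\mathbf{X}_t$ is a stationary zero-mean $N$-variate discrete-time process, $\Phi(s)$ are real $N\times N$ coefficient matrices, and $\varepsilon_t\sim\mathcal{N}(0,\Sigma)$ are independent and identically distributed in time with $\Sigma$ invertible; $\varepsilon_t$ is independent of the past $\mathbf{X}_{t-1},\mathbf{X}_{t-2},\ldots$. For a component $X$, $\varepsilon_{X,t}$ is the corresponding component of $\varepsilon_t$ and $\sigma_X^2=\Sigma_{XX}$ is its variance (similarly $\sigma_Y^2$). Time series graph: its nodes are the variables $X_t$ for each component $X$ of $\mathbf{X}$ and each time $t$. For this model class, for $\tau>0$ there is a directed link $X_{t-\tau}\to Y_t$ if and only if $\Phi_{YX}(\tau)\neq 0$ (with $\Phi(s)=0$ for $s>p$). The parents of $Y_t$ are $\mathcal{P}_{Y_t}=\{Z_{t-s}: Z \text{ a component of }\mathbf{X},\ s>0,\ Z_{t-s}\to Y_t\}$; past lags of $Y$ itself may be among the parents. Vector notation: $\mathbf{Z}_{t}$ is the row vector listing the elements of $\mathcal{P}_{X_t}$ and $A$ the column vector of the corresponding coefficients of $\Phi$; $\mathbf{W}_t$ is the row vector listing the elements of $\mathcal{P}_{Y_t}\setminus\{X_{t-\tau}\}$ and $B$ the column vector of the corresponding coefficients. For zero-mean random row vectors $\mathbf{a},\mathbf{b}$, $E[\mathbf{a}^\top\mathbf{b}]$ denotes the matrix with entries $E[a_ib_j]$; scalars are treated as $1\times1$ vectors. MIT: $\rho^{\rm MIT}_{X\to Y}(\tau)=\rho(X_{t-\tau};Y_t\mid\mathcal{P}_{Y_t}\setminus\{X_{t-\tau}\},\mathcal{P}_{X_{t-\tau}})$,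 the partial correlation given the listed conditioning variables, i.e. the correlation of the residuals after linear regression of both variables on them. *)

(* Defs.v *)
From HB Require Import structures.
From mathcomp Require Export all_boot all_order all_algebra.
From mathcomp Require Export all_classical all_reals all_analysis.

Set Implicit Arguments.
Unset Strict Implicit.
Unset Printing Implicit Defensive.

Import Order.TTheory GRing.Theory Num.Theory.
Import numFieldNormedType.Exports.

Local Open Scope classical_set_scope.
Local Open Scope ring_scope.

Section independence.
Context {d : measure_display} {T : measurableType d} {R : realType}.
Variable P : probability T R.

Definition sigma_of (I : Type) (J : set I) (F : I -> T -> R) : set (set T) :=
  <<s \bigcup_(i in J) preimage_set_system setT (F i) measurable >>.

Definition indep (F G : set (set T)) : Prop :=
  forall A B, F A -> G B -> P (A `&` B) = (P A * P B)%E.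

Definition mutually_indep (I : choiceType) (F : I -> set (set T)) : Prop :=
  forall (s : seq I) (A : I -> set T), uniq s ->
    (forall i, i \in s -> F i (A i)) ->
    P (\bigcap_(i in [set` s]) A i) = (\prod_(i <- s) P (A i))%E.

End independence.

Section gaussian.
Context {d : measure_display} {T : measurableType d} {R : realType}.
Variable P : probability T R.

(* [normal_prob 0 0] is not a point mass, whence the case distinction. *)
Definition centered_normal (s2 : R) : set R -> \bar R :=
  if s2 == 0 then \d_(0 : R) else normal_prob 0 (Num.sqrt s2).

(* N(0, Sigma): every linear form is centered normal, of variance
   a^T Sigma a. *)
Definition gaussian_vector N (Sigma : 'M[R]_N) (e : 'I_N -> T -> R) : Prop :=
  [/\ Sigma^T = Sigma,
      (forall a : 'cV[R]_N, 0 <= (a^T *m Sigma *m a) 0 0) &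
      forall (a : 'cV[R]_N) (B : set R), measurable B ->
        P [set w | B (\sum_(i < N) a i 0 * e i w)] =
        centered_normal ((a^T *m Sigma *m a) 0 0) B].

End gaussian.

Section moments.
Context {d : measure_display} {T : measurableType d} {R : realType}.
Variable P : probability T R.

(* E[a^T b] for random row vectors. *)
Definition moment m n (a : T -> 'rV[R]_m) (b : T -> 'rV[R]_n) : 'M[R]_(m, n) :=
  \matrix_(i, j) fine 'E_P[fun w => a w 0 i * b w 0 j].

Definition scalar_rv (f : T -> R) : T -> 'rV[R]_1 := fun w => (f w)%:M.

Definition row_mx_rv m n (a : T -> 'rV[R]_m) (b : T -> 'rV[R]_n) :
  T -> 'rV[R]_(m + n) := fun w => row_mx (a w) (b w).

Definition project_out m n (V : T -> 'rV[R]_n) (U : T -> 'rV[R]_m) :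
    T -> 'rV[R]_n :=
  fun w => V w - U w *m invmx (moment U U) *m moment U V.

Definition regression_residual m (V : T -> R) (U : T -> 'rV[R]_m)
    (ab : R * 'cV[R]_m) : T -> R :=
  fun w => V w - ab.1 - (U w *m ab.2) 0 0.

Definition least_squares m (V : T -> R) (U : T -> 'rV[R]_m) :
    set (R * 'cV[R]_m) :=
  [set ab | forall ab', ('E_P[fun w => (regression_residual V U ab w ^+ 2)%R] <=
      'E_P[fun w => (regression_residual V U ab' w ^+ 2)%R])%E].

(* For square-integrable variables a minimizer exists, and the residual does
   not depend, almost surely, on which one is chosen. *)
Definition residual m (V : T -> R) (U : T -> 'rV[R]_m) : T -> R :=
  regression_residual V U (xget (0, 0) (least_squares V U)).

Definition correlation (f g : T -> R) : R :=
  fine (covariance P f g) /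
  (Num.sqrt (fine 'V_P[f]) * Num.sqrt (fine 'V_P[g])).

Definition partial_correlation m (V1 V2 : T -> R) (U : T -> 'rV[R]_m) : R :=
  correlation (residual V1 U) (residual V2 U).

End moments.

(* The node (i, t) of the time series graph stands for the i-th component at
   time t. *)
Definition node (N : nat) : Type := ('I_N * int)%type.

Definition lag N (u v : node N) : nat := `|(v.2 - u.2)%R|%N.

(* Lagged links only; the condition on p encodes Phi(s) = 0 for s > p. *)
Definition link (R : realType) N (p : nat) (Phi : nat -> 'M[R]_N) : rel (node N) :=
  fun u v => [&& u.2 < v.2, (lag u v <= p)%N & Phi (lag u v) v.1 u.1 != 0].

(* [l] lists, without repetition and in any order, the nodes satisfying [A]. *)
Definition lists N (l : seq (node N)) (A : pred (node N)) : Prop :=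
  uniq l /\ l =i A.

Definition parents (R : realType) N p (Phi : nat -> 'M[R]_N) (v : node N) :
  pred (node N) := fun u => link p Phi u v.

Definition coef_col (R : realType) N (Phi : nat -> 'M[R]_N) (v : node N)
    (l : seq (node N)) : 'cV[R]_(size l) :=
  \col_k let u := tnth (in_tuple l) k in Phi (lag u v) v.1 u.1.

Section VAR.
Context {d : measure_display} {T : measurableType d} {R : realType}.
Variable P : probability T R.

Definition nodes_row N (X : int -> 'I_N -> {RV P >-> R}) (l : seq (node N)) :
    T -> 'rV[R]_(size l) :=
  fun w => \row_k let u := tnth (in_tuple l) k in X u.2 u.1 w.

(* Stationarity is second-order stationarity; since the innovations are
   Gaussian, i.i.d. and independent of the past, it entails that the process
   is Gaussian and strictly stationary. *)
Record gaussian_VAR N (p : nat) (Phi : nat -> 'M[R]_N) (Sigma : 'M[R]_N)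
    (X eps : int -> 'I_N -> {RV P >-> R}) : Prop := GaussianVAR {
  VAR_L2 : forall t i, (X t i : T -> R) \in Lfun P 2%:E ;
  VAR_mean0 : forall t i, ('E_P[X t i] = 0)%E ;
  VAR_stationary : forall t t' h i j,
    covariance P (X t i) (X (t + h) j) = covariance P (X t' i) (X (t' + h) j) ;
  VAR_eq : forall t i, {ae P, forall w, X t i w =
    \sum_(1 <= s < p.+1) \sum_(j < N) Phi s i j * X (t - s%:Z) j w
      + eps t i w} ;
  VAR_gaussian : forall t, gaussian_vector P Sigma (fun i => eps t i) ;
  VAR_Sigma_unit : Sigma \in unitmx ;
  VAR_eps_indep :
    mutually_indep P (fun t : int => sigma_of setT (fun i => eps t i)) ;
  VAR_eps_past : forall t,
    indep P (sigma_of setT (fun i => eps t i))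
            (sigma_of [set u : node N | u.2 < t] (fun u => X u.2 u.1))
}.

End VAR.

(* Main.v *)
Require Import Defs.
From mathcomp Require Import measurable_realfun ring zify.

Set Implicit Arguments.
Unset Strict Implicit.
Unset Printing Implicit Defensive.

Import Order.TTheory GRing.Theory Num.Theory.
Import numFieldNormedType.Exports.

Local Open Scope classical_set_scope.
Local Open Scope ring_scope.

(** With E[a b] as inner product on square-integrable random variables, all
the moments in the theorem are Gram matrices, and [project_out V U] is V minus
its orthogonal projection on the span of U. The inner product of two such
residuals is the partial covariance
  pcov V V' = E[V^T V'] - E[V^T U] E[U^T U]^-1 E[U^T V'],
which is bilinear and does not change when a linear combination of the
regressors U is added to V or V'.

The two regression equations therefore replace X by epsX, and Y by
D = c epsX + epsY, since Z A and W B lie in the span of U = (W, Z). The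
innovation epsY is independent of every component at an earlier time, and
these are centered, so it is orthogonal to U and to epsX, which is itself a
combination of X and Z.
Hence, with K = pcov epsX epsX,
  pcov X X = K,  pcov Y X = c K,  pcov Y Y = Sigma_YY + c^2 K.
Finally epsX is orthogonal to Z, so only the W-block of E[U^T U]^-1 enters K;
that block is the inverse of the Schur complement S_Z ([pcov_schur]).

Three facts need more than linear algebra.
 - The Gaussian law of the innovations enters through their variances
   ([expectation_innovation_sqr]). The second moment of a normal density phi
   of standard deviation s comes from phi' = - x / s^2 phi: phi is the tail
   integral of x / s^2 phi, and exchanging two integrals turns the integral of
   phi into that of (x / s)^2 phi.
 - Independence gives orthogonality ([indep_expectationM]): the law of an
   independent pair is a product measure, and Fubini applies.
 - The partial correlation is defined by least squares with an intercept. All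
   variables being centered, the normal equations with intercept decouple and
   their only solution is (0, E[U^T U]^-1 E[U^T V]), so that the least-squares
   residual is [project_out V U] ([residualE]). *)

(** * Integration against a density *)

Section density.
Context d (T : measurableType d) (R : realType).
Variables (mu nu : {measure set T -> \bar R}) (g : T -> R).
Hypotheses (mg : measurable_fun setT g) (g_ge0 : forall x, 0 <= g x).
Hypothesis nuE : forall A, measurable A ->
  nu A = (\int[mu]_(x in A) (g x)%:E)%E.

Import HBNNSimple.
Local Open Scope ereal_scope.

(** Both sides agree on indicators by hypothesis, hence on simple functions, and
monotone convergence does the rest. *)
Lemma ge0_integral_density (f : T -> \bar R) :
  measurable_fun setT f -> (forall x, 0 <= f x) ->
  \int[nu]_x f x = \int[mu]_x (f x * (g x)%:E).
Proof.
move=> mf f0; pose h := nnsfun_approx measurableT mf.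
have fE x : f x = lim ((EFin \o h n) x @[n --> \oo]).
  by apply/esym/cvg_lim => //; apply: cvg_nnsfun_approx.
have hfin n : \int[nu]_x (h n x)%:E = \int[mu]_x ((h n x)%:E * (g x)%:E).
  under eq_integral do rewrite fimfunE -fsumEFin//.
  rewrite ge0_integral_fsum//; last 2 first.
  - by move=> r; apply/measurable_EFinP; exact: measurable_funM.
  - by move=> r y _; exact: nnfun_muleindic_ge0.
  transitivity (\int[mu]_x (\sum_(r \in range (h n))
      ((r * \1_(h n @^-1` [set r]) x)%:E * (g x)%:E))); last first.
    apply: eq_integral => z _; rewrite -ge0_mule_fsuml; last first.
      by move=> r; exact: nnfun_muleindic_ge0.
    by rewrite fsumEFin// -fimfunE.
  rewrite ge0_integral_fsum//; last 2 first.
  - move=> r; apply: emeasurable_funM; apply/measurable_EFinP => //.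
    exact: measurable_funM.
  - by move=> r y _; rewrite mule_ge0 ?lee_fin ?g_ge0//; exact: nnfun_muleindic_ge0.
  apply: eq_fsbigr => r /[!inE] -[y _ <-].
  under eq_integral do rewrite EFinM.
  under [RHS]eq_integral do rewrite EFinM -muleA.
  rewrite ge0_integralZl//= ?lee_fin//; last first.
    by apply/measurable_EFinP; exact: measurable_indic.
  rewrite ge0_integralZl//= ?lee_fin//; last 2 first.
  - by apply: emeasurable_funM; apply/measurable_EFinP.
  - by move=> z _; rewrite mule_ge0 ?lee_fin.
  rewrite integral_indic// setIT nuE// [in LHS]integral_mkcond.
  congr (_ * _); apply: eq_integral => z _.
  by rewrite patchE indicE; case: ifPn; rewrite ?mul1e ?mul0e.
rewrite (eq_integral (fun x => lim ((EFin \o h n) x @[n --> \oo]))); last first.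
  by move=> x _; exact: fE.
rewrite monotone_convergence//; last 3 first.
- by move=> n; apply/measurable_EFinP.
- by move=> n x _; rewrite lee_fin.
- by move=> x _ a b ab; rewrite lee_fin; exact/lefP/nd_nnsfun_approx.
rewrite [RHS](eq_integral
    (fun x => lim (((h n x)%:E * (g x)%:E) @[n --> \oo]))); last first.
  move=> x _; apply/esym/cvg_lim => //; apply: cvgeZr => //.
  exact: cvg_nnsfun_approx.
rewrite monotone_convergence//; last 3 first.
- by move=> n; apply: emeasurable_funM; apply/measurable_EFinP.
- by move=> n x _; rewrite mule_ge0 ?lee_fin.
- move=> x _ a b ab; rewrite lee_wpmul2r ?lee_fin//.
  exact/lefP/nd_nnsfun_approx.
by congr (lim (_ @ \oo)); apply/funext => n; exact: hfin.
Qed.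

End density.

(** * The variance of a normal law *)

Section second_moment_from_tail.
Variables (R : realType) (s : R) (phi : R -> R).
Let mu := @lebesgue_measure R.
Hypotheses (s_neq0 : s != 0) (phi_ge0 : forall x, 0 <= phi x).
Hypothesis mphi : measurable_fun setT phi.
Hypothesis tail : forall u, 0 <= u ->
  (\int[mu]_(x in `[u, +oo[) (x / s ^+ 2 * phi x)%:E = (phi u)%:E)%E.

(** Integrate x / s^2 phi x over the wedge 0 <= u <= x in both orders: along u
it yields (x / s)^2 phi x, along x it yields the tail, which is phi u. *)
Lemma ge0_tail_second_moment :
  (\int[mu]_(x in [set x | (0 <= x)%R]) ((x / s) ^+ 2 * phi x)%:E =
   \int[mu]_(x in [set x | (0 <= x)%R]) (phi x)%:E)%E.
Proof.
pose D := [set z : R * R | 0 <= z.2 <= z.1].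
pose f (z : R * R) : \bar R := (\1_D z * (z.1 / s ^+ 2 * phi z.1))%:E.
have mD : measurable D.
  rewrite (_ : D = (fun z : R * R => (0 <= z.2)%R && (z.2 <= z.1)%R) @^-1`
      [set true]); last first.
    by apply/seteqP; split => z.
  rewrite -[X in measurable X]setTI.
  apply: measurable_and => //.
    exact: measurable_fun_ler.
  exact: measurable_fun_ler.
have mf : measurable_fun setT f.
  apply/measurable_EFinP/measurable_funM; first exact: measurable_indic.
  apply: measurable_funM; first exact: measurable_funM.
  exact: measurableT_comp.
have f0 z : (0 <= f z)%E.
  rewrite lee_fin /= indicE; case: (boolP (z \in D)); rewrite ?mul0r// mul1r.
  rewrite inE /D /= => /andP[a b].
  by rewrite mulr_ge0// divr_ge0 ?sqr_ge0// (le_trans a).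
have fub := @fubini_tonelli _ _ _ _ R mu mu f mf f0.
rewrite [LHS]integral_mkcond [RHS]integral_mkcond.
transitivity (\int[mu]_x \int[mu]_y f (x, y))%E; [|rewrite fub].
- apply: eq_integral => x _; rewrite patchE.
  case: ifPn; rewrite ?inE ?notin_setE /= => x0; last first.
    symmetry; apply: integral0_eq => y _; rewrite /f indicE memNset ?mul0r//.
    by rewrite /D /= => /andP[a b]; apply: x0; exact: le_trans b.
  transitivity (\int[mu]_y ((x / s ^+ 2 * phi x)%:E * (\1_`[0%R, x] y)%:E))%E.
    rewrite ge0_integralZl//; last 2 first.
    - by apply/measurable_EFinP; exact: measurable_indic.
    - by rewrite lee_fin mulr_ge0// divr_ge0 ?sqr_ge0.
    have mu0x : lebesgue_measure `[0%R, x]%classic = x%:E.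
      rewrite lebesgue_measure_itv/= lte_fin.
      by case: ltgtP x0 => // [_ _|<- _ //]; rewrite oppr0 adde0.
    rewrite integral_indic// setIT [X in (_ * X)%E]mu0x -EFinM.
    by congr (_%:E); field.
  apply: eq_integral => y _; rewrite /f -EFinM mulrC !indicE.
  by congr ((nat_of_bool _)%:R * _)%:E.
- apply: eq_integral => u _; rewrite patchE.
  case: ifPn; rewrite ?inE ?notin_setE /= => u0; last first.
    apply: integral0_eq => y _; rewrite /f indicE memNset ?mul0r//.
    by rewrite /D /= => /andP[].
  rewrite -tail// [RHS]integral_mkcond; apply: eq_integral => x _.
  rewrite /f patchE indicE; case: ifPn => xu.
    by rewrite mem_set ?mul1r// /D /= u0; move: xu; rewrite inE /= in_itv/= andbT.
  rewrite memNset ?mul0r// /D /= u0 /= => ux; move: xu.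
  by rewrite notin_setE /= in_itv /= andbT.
Qed.

End second_moment_from_tail.

Section normal_variance.
Variables (R : realType) (s : R).
Hypothesis s_gt0 : 0 < s.
Let mu := @lebesgue_measure R.
Let phi : R -> R := normal_pdf 0 s.

Let s_neq0 : s != 0. Proof. exact: lt0r_neq0. Qed.

Let phi_ge0 x : 0 <= phi x. Proof. exact: normal_pdf_ge0. Qed.

Let mphi : measurable_fun setT phi. Proof. exact: measurable_normal_pdf. Qed.

Let cphi : continuous phi. Proof. exact: continuous_normal_pdf. Qed.

Let phiE x : phi x = normal_peak s * expR (- (x ^+ 2 / (s ^+ 2 *+ 2))).
Proof. by rewrite /phi normal_pdfE// /normal_fun subr0 mulNr. Qed.

Let phiN x : phi (- x) = phi x. Proof. by rewrite !phiE sqrrN. Qed.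

Let is_derive_phi (x : R) : is_derive x 1 phi (- (x / s ^+ 2 * phi x)).
Proof.
rewrite phiE (_ : phi =
  (fun y => normal_peak s * expR ((- (s ^+ 2 *+ 2)^-1) * y ^+ 2))); last first.
  by apply/funext => y; rewrite phiE; congr (_ * expR _); rewrite mulNr mulrC.
apply: is_derive_eq.
rewrite /GRing.scale /= (_ : - _ * _ ^+ 2 = - (x ^+ 2 / (s ^+ 2 *+ 2))).
  by field.
by rewrite mulNr mulrC.
Qed.

Let phi_cvg0 : phi x @[x --> +oo] --> 0.
Proof.
rewrite -[X in _ --> X](mulr0 (normal_peak s)).
under eq_cvg do rewrite phiE.
apply: cvgMr.
apply: (@cvg_comp _ _ _ (fun x : R => x ^+ 2 / (s ^+ 2 *+ 2))
  (fun x => expR (- x)) _ (pinfty_nbhs R)); last exact: cvgr_expR.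
by apply: gt0_cvgMly; [rewrite invr_gt0 pmulrn_lgt0// exprn_gt0|exact: cvgr_expr2].
Qed.

(** The integrand is minus the derivative of phi, and phi vanishes at infinity. *)
Let tail u : 0 <= u ->
  (\int[mu]_(x in `[u, +oo[) (x / s ^+ 2 * phi x)%:E = (phi u)%:E)%E.
Proof.
move=> u0.
rewrite (@ge0_continuous_FTC2y _ _ (fun x => - phi x) u 0)//.
- by rewrite EFinN oppeK add0e.
- move=> x ux; rewrite mulr_ge0// divr_ge0 ?sqr_ge0//.
  exact: le_trans ux.
- apply: continuous_subspaceT => x; apply: cvgM; last exact: cphi.
  by apply: cvgMl; exact: cvg_id.
- by rewrite -oppr0; apply: cvgN.
- by move=> x _; apply: derivableN; exact: ex_derive.
- by apply: cvgN; apply: cvg_at_right_filter; exact: cphi.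
- by move=> x _; rewrite derive1E; have ? := is_derive_phi x; rewrite derive_val opprK.
Qed.

Lemma normal_second_moment :
  (\int[mu]_x (x ^+ 2 * phi x)%:E = (s ^+ 2)%:E)%E.
Proof.
transitivity ((s ^+ 2)%:E * \int[mu]_x ((x / s) ^+ 2 * phi x)%:E)%E.
  rewrite -ge0_integralZl//; last 3 first.
  - apply/measurable_EFinP/measurable_funM => //.
    by apply: measurable_funX; exact: measurable_funM.
  - by move=> x _; rewrite lee_fin mulr_ge0 ?sqr_ge0.
  - by rewrite lee_fin sqr_ge0.
  by apply: eq_integral => x _; rewrite -EFinM; congr (_%:E); field.
rewrite ge0_symfun_integralT; last 3 first.
- by move=> x; rewrite mulr_ge0 ?sqr_ge0.
- move=> x; apply: cvgM; last exact: cphi.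
  apply: (cvg_comp (fun x : R => x / s) (fun x => x ^+ 2)); last exact: sqr_continuous.
  by apply: cvgMl; exact: cvg_id.
- by move=> x /=; rewrite phiN mulNr sqrrN.
rewrite (ge0_tail_second_moment s_neq0 phi_ge0 mphi tail)
  -ge0_symfun_integralT//; last first.
  by move=> x /=; rewrite phiN.
by rewrite /phi integral_normal_pdf mule1.
Qed.

End normal_variance.

Section centered_normal_law.
Context d (T : measurableType d) (R : realType) (P : probability T R).

(** The law of [e] is transported to [measurableTypeR R] because the normal
law is a measure on that structure, whose measurable sets are those of [R] but
whose display differs. *)
Lemma centered_normal_sqr (s2 : R) (e : {RV P >-> R}) : 0 <= s2 ->
  (forall B, measurable B -> P [set w | B (e w)] = centered_normal s2 B) ->
  ('E_P[fun w => (e w ^+ 2)%R] = s2%:E)%E.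
Proof.
move=> s2_ge0 elaw; rewrite unlock.
pose e' : T -> measurableTypeR R := e.
have me' : measurable_fun setT e' by exact: (measurable_funP e).
pose sq : measurableTypeR R -> \bar R := fun r => (r ^+ 2)%:E.
have msq : measurable_fun setT sq.
  by apply/measurable_EFinP; exact: exprn_measurable.
have sq0 r : (0 <= sq r)%E by rewrite lee_fin sqr_ge0.
transitivity (\int[pushforward P e']_r sq r)%E.
  by rewrite ge0_integral_pushforward.
move: elaw; rewrite /centered_normal; case: eqVneq => [-> elaw|s2_neq0 elaw].
  transitivity (\int[\d_ ((0%R : R) : measurableTypeR R)]_r sq r)%E.
    by apply: eq_measure_integral => A mA _; exact: elaw.
  by rewrite integral_dirac// diracT mul1e /sq expr0n.
have s_gt0 : 0 < Num.sqrt s2 by rewrite sqrtr_gt0 lt0r s2_neq0.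
transitivity (\int[normal_prob 0 (Num.sqrt s2)]_r sq r)%E.
  by apply: eq_measure_integral => A mA _; exact: elaw.
rewrite (@ge0_integral_density _ _ _ lebesgue_measure _
  (normal_pdf 0 (Num.sqrt s2)))//; last 2 first.
- exact: measurable_normal_pdf.
- exact: normal_pdf_ge0.
under eq_integral do rewrite -EFinM.
by rewrite normal_second_moment// sqr_sqrtr.
Qed.

End centered_normal_law.

(** * Independent square-integrable variables are uncorrelated *)

Section independence.
Context d (T : measurableType d) (R : realType) (P : probability T R).
Variables f g : {RV P >-> R}.
Hypotheses (f2 : (f : T -> R) \in Lfun P 2%:E)
  (g2 : (g : T -> R) \in Lfun P 2%:E).
Hypothesis fg_indep : forall A B, measurable A -> measurable B ->
  P (f @^-1` A `&` g @^-1` B) = (P (f @^-1` A) * P (g @^-1` B))%E.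
Local Open Scope ereal_scope.

(** By uniqueness of the product measure, the law of the pair (f, g) is the
product of the laws of f and g; then Fubini factors the integral of the
product of the two coordinates. *)
Lemma indep_expectationM : 'E_P[fun w => (f w * g w)%R] = 'E_P[f] * 'E_P[g].
Proof.
have Pfin : P setT \is a fin_num := fin_num_measure P _ measurableT.
pose h w : R * R := (f w, g w).
have mh : measurable_fun setT h by exact/measurable_fun_prod.
pose m := pushforward P h.
pose mfd := distribution P f.
pose mgd := distribution P g.
pose q (z : R * R) : \bar R := (z.1 * z.2)%:E.
have mq : measurable_fun setT q.
  by apply/measurable_EFinP; exact: measurable_funM.
have intfg : P.-integrable setT (q \o h).
  exact/Lfun1_integrable/Lfun2_mul_Lfun1.
have mE A : measurable A -> (mfd \x mgd) A = m A.
  by apply: product_measure_unique => B C mB mC; exact: fg_indep.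
have intq : (mfd \x mgd).-integrable setT q.
  have /integrableP[_ qoo] : m.-integrable setT q by exact: integrable_pushforward.
  apply/integrableP; split => //; move: qoo; congr (_ < _)%E.
  by apply: eq_measure_integral => A mA _; apply/esym/mE.
transitivity (\int[m]_z q z).
  by rewrite unlock integral_pushforward.
transitivity (\int[mfd \x mgd]_z q z).
  by apply: eq_measure_integral => A mA _; apply/esym/mE.
have g1 : (g : T -> R) \in Lfun P 1 by exact: Lfun_subset12.
have f1 : (f : T -> R) \in Lfun P 1 by exact: Lfun_subset12.
have Eg : \int[mgd]_y y%:E = 'E_P[g].
  rewrite unlock [LHS](integral_distribution (f := EFin))//.
  exact/Lfun1_integrable.
have Ef : \int[mfd]_y y%:E = 'E_P[f].
  rewrite unlock [LHS](integral_distribution (f := EFin))//.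
  exact/Lfun1_integrable.
have ig : mgd.-integrable setT EFin.
  by apply: integrable_pushforward => //; exact/Lfun1_integrable.
have if' : mfd.-integrable setT EFin.
  by apply: integrable_pushforward => //; exact/Lfun1_integrable.
rewrite -integral12_prod_meas1// /fubini_F.
under eq_integral do rewrite /q /= ; rewrite /=.
under eq_integral => x _.
  under eq_integral do rewrite EFinM.
  rewrite integralZl// Eg; over.
rewrite -(fineK (expectation_fin_num g1)).
by rewrite integralZr// Ef.
Qed.

End independence.

(** * Moment matrices of square-integrable random vectors *)

Section moments.
Context d (T : measurableType d) (R : realType) (P : probability T R).
Local Notation "\E f" := (fine (expectation P f)) (at level 10, f at level 9).

Definition L2_row n (a : T -> 'rV[R]_n) : Prop :=
  forall j, (fun w => a w 0 j) \in Lfun P 2%:E.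

Lemma fine_expectation_lincomb (I : Type) (r : seq I) (F : I -> T -> R)
    (c : I -> R) : (forall i, F i \in Lfun P 1) ->
  (fun w => \sum_(i <- r) F i w * c i) \in Lfun P 1 /\
  \E (fun w => \sum_(i <- r) F i w * c i) = \sum_(i <- r) \E (F i) * c i.
Proof.
move=> F1; elim: r => [|i r [IH1 IH]].
  rewrite (_ : (fun w => _) = cst 0); last first.
    by apply/funext => w; rewrite big_nil.
  by rewrite big_nil expectation_cst; split => //; exact: Lfun_cst.
rewrite (_ : (fun w => _) =
  (c i \o* F i) \+ (fun w => \sum_(j <- r) F j w * c j)); last first.
  by apply/funext => w; rewrite big_cons /=.
have cF1 : (c i \o* F i) \in Lfun P 1 by exact: Lfun_scale.
split; first exact: rpredD.
rewrite expectationD// fineD ?expectation_fin_num// big_cons IH; congr (_ + _).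
by rewrite expectationZl// fineM// ?expectation_fin_num// mulrC.
Qed.

Lemma Lfun2D (f g : T -> R) : f \in Lfun P 2%:E -> g \in Lfun P 2%:E ->
  f \+ g \in Lfun P 2%:E.
Proof. by move=> f2 g2; apply: (Lfun_addr_closed P (lee1n 2)).2. Qed.

Lemma Lfun2_lincomb (I : Type) (r : seq I) (F : I -> T -> R) (c : I -> R) :
  (forall i, F i \in Lfun P 2%:E) ->
  (fun w => \sum_(i <- r) F i w * c i) \in Lfun P 2%:E.
Proof.
move=> F2; elim: r => [|i r IH].
  rewrite (_ : (fun w => _) = cst 0); first exact: Lfun_cst.
  by apply/funext => w; rewrite big_nil.
rewrite (_ : (fun w => _) =
  (c i \o* F i) \+ (fun w => \sum_(j <- r) F j w * c j)); last first.
  by apply/funext => w; rewrite big_cons /=.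
apply: Lfun2D => //; apply: Lfun_scale => //; exact: ler1n.
Qed.

Lemma L2_row_scalar (f : T -> R) : f \in Lfun P 2%:E -> L2_row (scalar_rv f).
Proof.
move=> f2 j; rewrite (_ : (fun w => _) = f)//.
by apply/funext => w; rewrite !ord1 mxE eqxx mulr1n.
Qed.

Lemma L2_row_mx m n (a : T -> 'rV[R]_m) (b : T -> 'rV[R]_n) :
  L2_row a -> L2_row b -> L2_row (row_mx_rv a b).
Proof.
move=> a2 b2 j; rewrite /row_mx_rv.
by case: (split_ordP j) => k ->; under eq_fun do rewrite ?row_mxEl ?row_mxEr.
Qed.

Lemma L2_row_mulmx m n (a : T -> 'rV[R]_m) (M : 'M[R]_(m, n)) :
  L2_row a -> L2_row (fun w => a w *m M).
Proof.
move=> a2 j; under eq_fun do rewrite mxE.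
exact: Lfun2_lincomb.
Qed.

Lemma L2_rowD n (a b : T -> 'rV[R]_n) :
  L2_row a -> L2_row b -> L2_row (fun w => a w + b w).
Proof.
move=> a2 b2 j; under eq_fun do rewrite mxE.
by apply: Lfun2D; [exact: a2|exact: b2].
Qed.

Lemma L2_rowB n (a b : T -> 'rV[R]_n) :
  L2_row a -> L2_row b -> L2_row (fun w => a w - b w).
Proof.
move=> a2 b2; rewrite (_ : (fun w => _) = fun w => a w + b w *m (-1)%:M).
  by apply: L2_rowD => //; exact: L2_row_mulmx.
by apply/funext => w; rewrite mul_mx_scalar scaleN1r.
Qed.

Lemma moment_tr m n (a : T -> 'rV[R]_m) (b : T -> 'rV[R]_n) :
  (moment P a b)^T = moment P b a.
Proof.
apply/matrixP => i j; rewrite !mxE; congr (fine (expectation _ _)).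
by apply/funext => w; rewrite mulrC.
Qed.

Lemma moment_row_mxr l m n (a : T -> 'rV[R]_l) (b : T -> 'rV[R]_m)
    (c : T -> 'rV[R]_n) :
  moment P a (row_mx_rv b c) = row_mx (moment P a b) (moment P a c).
Proof.
apply/matrixP => i j; rewrite !mxE /row_mx_rv.
case: (split_ordP j) => k ->; rewrite !mxE; congr (fine (expectation _ _)).
  by apply/funext => w; rewrite row_mxEl.
by apply/funext => w; rewrite row_mxEr.
Qed.

Lemma moment_row_mxl l m n (a : T -> 'rV[R]_l) (b : T -> 'rV[R]_m)
    (c : T -> 'rV[R]_n) :
  moment P (row_mx_rv b c) a = col_mx (moment P b a) (moment P c a).
Proof. by rewrite -moment_tr moment_row_mxr tr_row_mx !moment_tr. Qed.

Lemma moment_mulmxr l m n (a : T -> 'rV[R]_l) (b : T -> 'rV[R]_m)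
    (M : 'M[R]_(m, n)) : L2_row a -> L2_row b ->
  moment P a (fun w => b w *m M) = moment P a b *m M.
Proof.
move=> a2 b2; apply/matrixP => i j; rewrite !mxE.
under [RHS]eq_bigr do rewrite mxE.
have [_ <-] := @fine_expectation_lincomb _ (index_enum 'I_m)
  (fun k w => a w 0 i * b w 0 k) (M ^~ j)
  (fun k => Lfun2_mul_Lfun1 (a2 i) (b2 k)).
congr (fine (expectation _ _)); apply/funext => w.
by rewrite mxE mulr_sumr; apply: eq_bigr => k _; rewrite mulrA.
Qed.

Lemma moment_mulmxl l m n (a : T -> 'rV[R]_l) (b : T -> 'rV[R]_m)
    (M : 'M[R]_(m, n)) : L2_row a -> L2_row b ->
  moment P (fun w => b w *m M) a = M^T *m moment P b a.
Proof. by move=> a2 b2; rewrite -moment_tr moment_mulmxr// trmx_mul moment_tr. Qed.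

Lemma momentDr m n (a : T -> 'rV[R]_m) (b c : T -> 'rV[R]_n) :
  L2_row a -> L2_row b -> L2_row c ->
  moment P a (fun w => b w + c w) = moment P a b + moment P a c.
Proof.
move=> a2 b2 c2; apply/matrixP => i j; rewrite !mxE.
have ab1 := Lfun2_mul_Lfun1 (a2 i) (b2 j).
have ac1 := Lfun2_mul_Lfun1 (a2 i) (c2 j).
rewrite -fineD ?expectation_fin_num// -expectationD//.
congr (fine (expectation _ _)); apply/funext => w.
by rewrite mxE mulrDr.
Qed.

Lemma momentBr m n (a : T -> 'rV[R]_m) (b c : T -> 'rV[R]_n) :
  L2_row a -> L2_row b -> L2_row c ->
  moment P a (fun w => b w - c w) = moment P a b - moment P a c.
Proof.
move=> a2 b2 c2.
rewrite (_ : (fun w => b w - c w) = fun w => b w + c w *m (-1)%:M).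
  by rewrite momentDr ?moment_mulmxr ?mul_mx_scalar ?scaleN1r//; exact: L2_row_mulmx.
by apply/funext => w; rewrite mul_mx_scalar scaleN1r.
Qed.

Lemma momentBl m n (a : T -> 'rV[R]_m) (b c : T -> 'rV[R]_n) :
  L2_row a -> L2_row b -> L2_row c ->
  moment P (fun w => b w - c w) a = moment P b a - moment P c a.
Proof. by move=> a2 b2 c2; rewrite -moment_tr momentBr// linearB/= !moment_tr. Qed.

Lemma moment_aer m n (a : T -> 'rV[R]_m) (b c : T -> 'rV[R]_n) :
  L2_row a -> L2_row b -> L2_row c -> {ae P, forall w, b w = c w} ->
  moment P a b = moment P a c.
Proof.
move=> a2 b2 c2 bc; apply/matrixP => i j; rewrite !mxE; congr fine.
rewrite unlock; apply: ae_eq_integral => //.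
- by have /Lfun1_integrable/measurable_int := Lfun2_mul_Lfun1 (a2 i) (b2 j).
- by have /Lfun1_integrable/measurable_int := Lfun2_mul_Lfun1 (a2 i) (c2 j).
- by apply: filterS bc => w -> _.
Qed.

Lemma moment_ael m n (a : T -> 'rV[R]_m) (b c : T -> 'rV[R]_n) :
  L2_row a -> L2_row b -> L2_row c -> {ae P, forall w, b w = c w} ->
  moment P b a = moment P c a.
Proof. by move=> *; rewrite -moment_tr (@moment_aer _ _ _ _ c)// moment_tr. Qed.

End moments.

(** * The Schur complement *)

(** Left multiplication by L = [[1, - B D^-1], [0, 1]] eliminates the upper right
block and leaves S in the upper left one; reading the upper left block of
(L M) M^-1 = L gives S N = 1 for the corresponding block N of M^-1. *)
Lemma invmx_block_ul (F : fieldType) m n (A : 'M[F]_m) (B : 'M[F]_(m, n))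
    (C : 'M[F]_(n, m)) (D : 'M[F]_n) : D \in unitmx -> block_mx A B C D \in unitmx ->
  let S := A - B *m invmx D *m C in
  S \in unitmx /\ ulsubmx (invmx (block_mx A B C D)) = invmx S.
Proof.
move=> Du Mu S; set M := block_mx A B C D in Mu *.
pose L := block_mx (1%:M : 'M[F]_m) (- (B *m invmx D))
  (0 : 'M[F]_(n, m)) (1%:M : 'M[F]_n).
have LM : L *m M = block_mx S 0 C D.
  rewrite mulmx_block !mul1mx !mul0mx !add0r mulNmx mulNmx -mulmxA.
  by rewrite -mulmxA mulVmx// mulmx1 subrr mulmxA.
have Su : S \in unitmx.
  have : L *m M \in unitmx.
    by rewrite unitmx_mul Mu andbT unitmxE det_ublock !det1 mulr1 unitr1.
  by rewrite LM unitmxE det_lblock unitrM => /andP[].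
split=> //.
have : block_mx S 0 C D *m invmx M = L by rewrite -LM -mulmxA mulmxV// mulmx1.
rewrite -{1}(submxK (invmx M)) mulmx_block => /eq_block_mx[+ _ _ _].
by rewrite mul0mx addr0 => SN; rewrite -[LHS](mulKmx Su) SN mulmx1.
Qed.

(** * Projection on the span of the regressors *)

Section projection.
Context d (T : measurableType d) (R : realType) (P : probability T R).

Lemma moment_self_ge0 (f : T -> 'rV[R]_1) : 0 <= moment P f f 0 0.
Proof. by rewrite mxE fine_ge0// expectation_ge0// => w; rewrite -expr2 sqr_ge0. Qed.

(** A variable of second moment zero vanishes almost surely. *)
Lemma moment_self_eq0 m (a : T -> 'rV[R]_m) (f : T -> 'rV[R]_1) :
  L2_row P a -> L2_row P f -> moment P f f 0 0 = 0 -> moment P a f = 0.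
Proof.
move=> a2 f2; rewrite mxE => f0.
have ff1 := Lfun2_mul_Lfun1 (f2 0) (f2 0).
have cst2 : L2_row P (fun _ : T => 0 : 'rV[R]_1).
  by move=> j; under eq_fun do rewrite mxE; exact: Lfun_cst.
have fae : {ae P, forall w, f w = 0}.
  have mff : measurable_fun setT (fun w => (f w 0 0 * f w 0 0)%:E).
    by have /Lfun1_integrable/measurable_int := ff1.
  have : (\int[P]_w `|(f w 0%R 0%R * f w 0%R 0%R)%:E|)%E = 0%E.
    have := fineK (expectation_fin_num ff1); rewrite f0 unlock => E0; rewrite [RHS]E0.
    by apply: eq_integral => w _; rewrite gee0_abs// lee_fin -expr2 sqr_ge0.
  move/(ae_eq_integral_abs P measurableT mff).
  apply: filterS => w /(_ I)/= [] /eqP; rewrite mulf_eq0 orbb => /eqP fw.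
  by apply/rowP => j; rewrite ord1 fw mxE.
rewrite (moment_aer a2 f2 cst2 fae).
apply/matrixP => i j; rewrite !mxE.
under eq_fun do rewrite mulr0.
by rewrite expectation_cst.
Qed.

Section gram.
Variables (m : nat) (U : T -> 'rV[R]_m).
Hypothesis U2 : L2_row P U.

Lemma moment_linear_form n (b : 'M[R]_(m, n)) :
  moment P (fun w => U w *m b) (fun w => U w *m b) = b^T *m moment P U U *m b.
Proof.
by rewrite moment_mulmxl ?moment_mulmxr ?mulmxA//; exact: L2_row_mulmx.
Qed.

(** The form is E[(U b)^2], so that U b = 0 almost surely; pairing with U gives
E[U^T U] b = 0, and the Gram matrix is invertible. *)
Lemma gram_definite (b : 'cV[R]_m) : moment P U U \in unitmx ->
  (b^T *m moment P U U *m b) 0 0 = 0 -> b = 0.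
Proof.
rewrite -moment_linear_form => Gu /(moment_self_eq0 U2 (L2_row_mulmx b U2)).
by rewrite moment_mulmxr// => /(congr1 (mulmx (invmx (moment P U U))));
  rewrite mulKmx// mulmx0.
Qed.

End gram.

(** A kernel vector v of the minor, padded with zeros, annihilates the definite
form of the whole Gram matrix. *)
Lemma gram_minor_unitmx m n (W : T -> 'rV[R]_m) (Z : T -> 'rV[R]_n) :
  L2_row P W -> L2_row P Z ->
  moment P (row_mx_rv W Z) (row_mx_rv W Z) \in unitmx ->
  moment P Z Z \in unitmx.
Proof.
move=> W2 Z2 Gu; rewrite unitmxE unitfE; apply/det0P => -[v v0 vZ].
have : col_mx 0 v^T = 0 :> 'cV[R]_(m + n).
  apply: (gram_definite (L2_row_mx W2 Z2) Gu).
  rewrite moment_row_mxl !moment_row_mxr -[col_mx (row_mx _ _) _]/(block_mx _ _ _ _).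
  rewrite tr_col_mx trmx0 trmxK mul_row_block !mul0mx !add0r vZ.
  by rewrite mul_row_col mulmx0 mul0mx addr0 mxE.
rewrite -col_mx0 => /eq_col_mx[_ /(congr1 trmx)].
by rewrite trmxK trmx0; apply/eqP.
Qed.

Section partial_covariance.
Variables (m : nat) (U : T -> 'rV[R]_m).
Hypotheses (U2 : L2_row P U) (Gu : moment P U U \in unitmx).

(** The partial covariance of V and V' given U, see [moment_project_out]; for
V = V' it is a Schur complement in the Gram matrix of (V, U). *)
Definition pcov k n (V : T -> 'rV[R]_k) (V' : T -> 'rV[R]_n) : 'M[R]_(k, n) :=
  moment P V V' - moment P V U *m invmx (moment P U U) *m moment P U V'.

Lemma L2_project_out n (V : T -> 'rV[R]_n) : L2_row P V ->
  L2_row P (project_out P V U).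
Proof.
move=> V2; rewrite /project_out.
by under eq_fun do rewrite -mulmxA; apply: L2_rowB => //; exact: L2_row_mulmx.
Qed.

Lemma moment_project_outr n k (V : T -> 'rV[R]_n) (a : T -> 'rV[R]_k) :
  L2_row P V -> L2_row P a -> moment P a (project_out P V U) = pcov a V.
Proof.
move=> V2 a2; rewrite /project_out.
under eq_fun do rewrite -mulmxA.
by rewrite momentBr ?moment_mulmxr /pcov ?mulmxA//; exact: L2_row_mulmx.
Qed.

Lemma project_out_orth n (V : T -> 'rV[R]_n) : L2_row P V ->
  moment P U (project_out P V U) = 0.
Proof. by move=> V2; rewrite moment_project_outr// /pcov mulmxV// mul1mx subrr. Qed.

Lemma moment_project_out n k (V : T -> 'rV[R]_n) (V' : T -> 'rV[R]_k) :
  L2_row P V -> L2_row P V' ->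
  moment P (project_out P V U) (project_out P V' U) = pcov V V'.
Proof.
move=> V2 V'2; have pV2 := L2_project_out V'2.
rewrite {1}/project_out; under eq_fun do rewrite -mulmxA.
rewrite momentBl//; last exact: L2_row_mulmx.
by rewrite moment_mulmxl// project_out_orth// mulmx0 subr0 moment_project_outr.
Qed.

(** Pythagoras: V - U b is the sum of the residual, which is orthogonal to U,
and of a vector in the span of U. *)
Lemma moment_regression n (V : T -> 'rV[R]_n) (b : 'M[R]_(m, n)) : L2_row P V ->
  let b0 := invmx (moment P U U) *m moment P U V in
  moment P (fun w => V w - U w *m b) (fun w => V w - U w *m b) =
  moment P (project_out P V U) (project_out P V U) +
    (b - b0)^T *m moment P U U *m (b - b0).
Proof.
move=> V2 b0; have pV2 := L2_project_out V2.
have Ub2 := L2_row_mulmx (b - b0) U2.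
rewrite (_ : (fun w => V w - U w *m b) =
  fun w => project_out P V U w - U w *m (b - b0)); last first.
  apply/funext => w; rewrite /project_out mulmxBr opprB -!mulmxA -/b0.
  by rewrite addrA subrK.
move: (project_out P V U) (project_out_orth V2) pV2 => r Ur r2.
rewrite momentBl//; last exact: L2_rowB.
rewrite !momentBr// (moment_mulmxl _ r2 U2) (moment_mulmxr _ r2 U2) Ur.
rewrite -[moment P r U]moment_tr Ur trmx0 mul0mx mulmx0 subr0.
by rewrite moment_linear_form// sub0r opprK.
Qed.

End partial_covariance.
End projection.

(** * Least-squares residuals of centered variables *)

Section least_squares_residual.
Context d (T : measurableType d) (R : realType) (P : probability T R).
Variables (m : nat) (U : T -> 'rV[R]_m).
Let one : T -> 'rV[R]_1 := fun _ => 1%:M.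
Hypotheses (U2 : L2_row P U) (Gu : moment P U U \in unitmx).
Hypothesis U_centered : moment P one U = 0.

Lemma L2_one : L2_row P one.
Proof. by move=> j; exact: Lfun_cst. Qed.

Lemma moment_one : moment P one one = 1%:M.
Proof.
apply/matrixP => i j; rewrite !ord1 mxE /one [1%:M 0 0]mxE mulr1.
by rewrite expectation_cst.
Qed.

(** Centered regressors are orthogonal to the constants, so that regressing with
an intercept is regressing on the pair (1, U) with a block-diagonal Gram
matrix. *)
Lemma moment_intercept :
  moment P (row_mx_rv one U) (row_mx_rv one U) = block_mx 1%:M 0 0 (moment P U U).
Proof.
rewrite moment_row_mxl !moment_row_mxr moment_one U_centered.
by rewrite -[moment P U one]moment_tr U_centered trmx0.
Qed.

Lemma moment_intercept_unitmx :
  moment P (row_mx_rv one U) (row_mx_rv one U) \in unitmx.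
Proof. by rewrite moment_intercept unitmxE det_ublock det1 mul1r. Qed.

Section residual.
Variable V : T -> R.
Hypotheses (V2 : V \in Lfun P 2%:E) (V_centered : moment P one (scalar_rv V) = 0).
Let Vr := scalar_rv V.
Let Vr2 : L2_row P Vr := L2_row_scalar V2.
Let b0 := invmx (moment P U U) *m moment P U Vr.
Let U1 := row_mx_rv one U.
Let U1_2 : L2_row P U1 := L2_row_mx L2_one U2.

(** The intercept of the normal equations is E[V] = 0. *)
Let b1E : invmx (moment P U1 U1) *m moment P U1 Vr = col_mx 0 b0.
Proof.
rewrite moment_intercept invmx_block_diag -?moment_intercept ?moment_intercept_unitmx//.
rewrite moment_row_mxl V_centered mul_block_col !mulmx0 mul0mx !add0r.
by [].
Qed.

Let mse (ab : R * 'cV[R]_m) :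
  'E_P[fun w => (regression_residual V U ab w ^+ 2)%R]%E =
  ((moment P (project_out P Vr U1) (project_out P Vr U1) +
    (col_mx ab.1%:M (ab.2 - b0))^T *m moment P U1 U1 *m
     (col_mx ab.1%:M (ab.2 - b0))) 0 0)%:E.
Proof.
rewrite (_ : col_mx ab.1%:M (ab.2 - b0) =
    col_mx ab.1%:M ab.2 - col_mx 0 b0); last first.
  by rewrite opp_col_mx add_col_mx subr0.
rewrite -b1E -moment_regression//; last exact: moment_intercept_unitmx.
have r2 : L2_row P (fun w => Vr w - U1 w *m col_mx ab.1%:M ab.2).
  by apply: L2_rowB => //; exact: L2_row_mulmx.
rewrite mxE fineK; last exact: expectation_fin_num (Lfun2_mul_Lfun1 (r2 0) (r2 0)).
congr expectation; apply/funext => w; rewrite -expr2; congr (_ ^+ 2).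
rewrite /regression_residual /U1 /row_mx_rv mul_row_col mul1mx.
by rewrite !mxE eqxx !mulr1n opprD addrA.
Qed.

(** By [mse], the mean square error exceeds its value at (0, b0) by a form that
is positive definite since the Gram matrix of (1, U) is invertible. *)
Lemma least_squaresE : least_squares P V U = [set (0, b0)].
Proof.
pose form (ab : R * 'cV[R]_m) := let v := col_mx ab.1%:M (ab.2 - b0) in
  (v^T *m moment P U1 U1 *m v) 0 0.
have form_ge0 ab : 0 <= form ab.
  by rewrite /form -moment_linear_form//; exact: moment_self_ge0.
have form0 : form (0, b0) = 0.
  by rewrite /form /= subrr raddf0 col_mx0 mulmx0 mxE.
have mse_le ab ab' : ('E_P[fun w => (regression_residual V U ab w ^+ 2)%R] <=
    'E_P[fun w => (regression_residual V U ab' w ^+ 2)%R])%E = (form ab <= form ab').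
  by rewrite !mse lee_fin [leLHS]mxE [leRHS]mxE lerD2l.
apply/seteqP; split => [ab /= min|_ -> ab']; last by rewrite mse_le form0.
have /eqP form_ab : form ab == 0.
  by rewrite eq_le form_ge0 andbT -form0 -mse_le; exact: min.
have := gram_definite U1_2 moment_intercept_unitmx form_ab.
rewrite -col_mx0 => /eq_col_mx[/matrixP/(_ 0 0) + /eqP].
rewrite !mxE eqxx mulr1n subr_eq0 => a0 /eqP bb0.
by rewrite [ab]surjective_pairing a0 bb0.
Qed.

Lemma residualE w : residual P V U w = project_out P Vr U w 0 0.
Proof.
rewrite /residual least_squaresE (xget_unique _ (x := (0, b0)))//.
rewrite /regression_residual /= subr0 /project_out -mulmxA -/b0 [RHS]mxE.
by congr (_ + _); [rewrite mxE eqxx mulr1n|rewrite [RHS]mxE].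
Qed.

Lemma expectation_residual : 'E_P[residual P V U]%E = 0%E.
Proof.
have r2 := L2_project_out U2 Vr2.
have r0 : moment P one (project_out P Vr U) 0 0 = 0.
  rewrite moment_project_outr//; last exact: L2_one.
  by rewrite /pcov V_centered U_centered !mul0mx subr0 mxE.
have /Lfun2_mul_Lfun1/(_ (r2 0)) r1 : (fun w => one w 0 0) \in Lfun P 2%:E.
  exact: L2_one.
transitivity (moment P one (project_out P Vr U) 0 0)%:E; last by rewrite r0.
rewrite mxE fineK; last exact: expectation_fin_num r1.
by congr expectation; apply/funext => w; rewrite residualE [one w 0 0]mxE mul1r.
Qed.

End residual.

Lemma covariance_residual (V V' : T -> R) :
  V \in Lfun P 2%:E -> V' \in Lfun P 2%:E ->
  moment P one (scalar_rv V) = 0 -> moment P one (scalar_rv V') = 0 ->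
  fine (covariance P (residual P V U) (residual P V' U)) =
  moment P (project_out P (scalar_rv V) U) (project_out P (scalar_rv V') U) 0 0.
Proof.
move=> V2 V'2 V0 V'0; rewrite unlock !expectation_residual//= mxE.
congr (fine (expectation _ _)); apply/funext => w.
by rewrite !fctE /= !subr0 !residualE.
Qed.

Lemma partial_correlationE (V V' : T -> R) :
  V \in Lfun P 2%:E -> V' \in Lfun P 2%:E ->
  moment P one (scalar_rv V) = 0 -> moment P one (scalar_rv V') = 0 ->
  let VU := project_out P (scalar_rv V) U in
  let V'U := project_out P (scalar_rv V') U in
  partial_correlation P V V' U = moment P VU V'U 0 0 /
    (Num.sqrt (moment P VU VU 0 0) * Num.sqrt (moment P V'U V'U 0 0)).
Proof.
move=> V2 V'2 V0 V'0 VU V'U.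
by rewrite /partial_correlation /correlation /variance !covariance_residual.
Qed.

End least_squares_residual.

(** * Innovations and past of a Gaussian autoregression *)

Lemma Lfun2_of_expectation_sqr d (T : measurableType d) (R : realType)
    (P : probability T R) (f : {RV P >-> R}) :
  ('E_P[fun w => (f w ^+ 2)%R] < +oo)%E -> (f : T -> R) \in Lfun P 2%:E.
Proof.
move=> f2; rewrite inE; apply/andP; split; rewrite inE//=.
rewrite /finite_norm unlock /Lnorm poweR_lty//.
move: f2; rewrite unlock; congr (_ < _)%E; apply: eq_integral => w _.
by rewrite /= powR_mulrn// -normrX ger0_norm// sqr_ge0.
Qed.

Section VAR.
Context d (T : measurableType d) (R : realType) (P : probability T R).
Variables (N p : nat) (Phi : nat -> 'M[R]_N) (Sigma : 'M[R]_N).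
Variables X eps : int -> 'I_N -> {RV P >-> R}.
Hypothesis hVAR : gaussian_VAR p Phi Sigma X eps.

(** The Gaussian law is given through linear forms; the i-th basis vector picks
the i-th component, of variance [Sigma i i]. *)
Lemma expectation_innovation_sqr t i :
  ('E_P[fun w => (eps t i w ^+ 2)%R] = (Sigma i i)%:E)%E.
Proof.
have [_ Spsd Slaw] := VAR_gaussian hVAR t.
have e_lin w : \sum_(k < N) (delta_mx i 0 : 'cV[R]_N) k 0 * eps t k w = eps t i w.
  rewrite (bigD1 i)//= big1 => [|k ki]; last by rewrite mxE (negbTE ki) mul0r.
  by rewrite mxE !eqxx mul1r addr0.
have form : ((delta_mx i 0 : 'cV[R]_N)^T *m Sigma *m (delta_mx i 0 : 'cV[R]_N)) 0 0
    = Sigma i i.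
  by rewrite trmx_delta -rowE -colE !mxE.
have Sii : 0 <= Sigma i i by rewrite -form; exact: Spsd.
apply: centered_normal_sqr => // B mB.
rewrite -form -(Slaw (delta_mx i 0) B mB).
by congr (P _); apply/seteqP; split => w /=; rewrite e_lin.
Qed.

Lemma innovation_L2 t i : (eps t i : T -> R) \in Lfun P 2%:E.
Proof. by apply: Lfun2_of_expectation_sqr; rewrite expectation_innovation_sqr ltry. Qed.

Lemma moment_innovation t i :
  moment P (scalar_rv (eps t i)) (scalar_rv (eps t i)) = (Sigma i i)%:M.
Proof.
apply/matrixP => a b; rewrite !ord1 !mxE eqxx mulr1n.
rewrite -[RHS]/(fine (Sigma i i)%:E) -(expectation_innovation_sqr t).
by congr (fine (expectation _ _)); apply/funext => w; rewrite !mxE eqxx mulr1n.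
Qed.

Lemma L2_nodes_row l : L2_row P (nodes_row X l).
Proof.
move=> j; under eq_fun do rewrite mxE.
exact: (VAR_L2 hVAR).
Qed.

Lemma nodes_row_centered l : moment P (fun _ => 1%:M : 'rV[R]_1) (nodes_row X l) = 0.
Proof.
apply/matrixP => i j; rewrite !mxE ord1 eqxx mulr1n.
rewrite -[RHS]/(fine (0%R : \bar R)).
rewrite -(VAR_mean0 hVAR (tnth (in_tuple l) j).2 (tnth (in_tuple l) j).1).
by congr (fine (expectation _ _)); apply/funext => w; rewrite mxE mul1r.
Qed.

Lemma component_centered t i :
  moment P (fun _ => 1%:M : 'rV[R]_1) (scalar_rv (X t i)) = 0.
Proof.
apply/matrixP => a b; rewrite !mxE !ord1 eqxx mulr1n.
rewrite -[RHS]/(fine (0%R : \bar R)) -(VAR_mean0 hVAR t i).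
by congr (fine (expectation _ _)); apply/funext => w; rewrite mxE mul1r.
Qed.

(** Independence factors the expectation, and the past component is centered. *)
Lemma expectation_past_innovation (u : node N) t i : u.2 < t ->
  'E_P[fun w => (X u.2 u.1 w * eps t i w)%R]%E = 0%E.
Proof.
move=> ut; rewrite indep_expectationM; first by rewrite (VAR_mean0 hVAR) mul0e.
- exact: (VAR_L2 hVAR).
- exact: innovation_L2.
move=> A B mA mB; rewrite setIC muleC; apply: (VAR_eps_past hVAR (t := t)).
- by apply: sub_sigma_algebra; exists i => //; exists B => //; rewrite setTI.
- by apply: sub_sigma_algebra; exists u => //; exists A => //; rewrite setTI.
Qed.

Lemma moment_past_innovation l t i : (forall u, u \in l -> u.2 < t) ->
  moment P (nodes_row X l) (scalar_rv (eps t i)) = 0.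
Proof.
move=> lt; apply/matrixP => a b; rewrite !mxE !ord1.
have /(expectation_past_innovation i) e0 :
  (tnth (in_tuple l) a).2 < t by apply: lt; exact: mem_tnth.
rewrite -[RHS]/(fine (0%R : \bar R)) -e0.
by congr (fine (expectation _ _)); apply/funext => w; rewrite !mxE eqxx mulr1n.
Qed.

Lemma nodes_row_coef (v : node N) l w :
  (nodes_row X l w *m coef_col Phi v l) 0 0 =
  \sum_(u <- l) X u.2 u.1 w * Phi (lag u v) v.1 u.1.
Proof. by rewrite mxE [RHS]big_tnth; apply: eq_bigr => k _; rewrite !mxE. Qed.

(** Pairs (s, j) with 1 <= s <= p correspond to nodes at lag s before v; those
that are not parents of v have coefficient zero. *)
Lemma lag_sum_parents (v : node N) l (f : node N -> R) : lists l (parents p Phi v) ->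
  \sum_(1 <= s < p.+1) \sum_(j < N) Phi s v.1 j * f (j, v.2 - s%:Z) =
  \sum_(u <- l) f u * Phi (lag u v) v.1 u.1.
Proof.
case: v => i t [ul lE] /=.
pose L := [seq (j, t - s%:Z) | s <- index_iota 1 p.+1, j <- index_enum 'I_N].
have lagE s j : lag (j, t - s%:Z) (i, t) = s.
  by rewrite /lag /= opprB addrC subrK absz_nat.
transitivity (\sum_(u <- L) f u * Phi (lag u (i, t)) i u.1).
  rewrite /L big_allpairs_dep; apply: eq_bigr => s _; apply: eq_bigr => j _.
  by rewrite lagE mulrC.
rewrite (bigID (parents p Phi (i, t))) /= [X in _ + X]big_seq_cond.
rewrite [X in _ + X]big1 ?addr0; last first.
  move=> u /andP[/allpairsP[[s j] [+ _ ->]]] /=.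
  rewrite mem_index_iota ltnS /parents /link /= lagE => /andP[s0 ->].
  rewrite gtrBl ltz_nat s0 /= negbK => /eqP ->; exact: mulr0.
rewrite -big_filter; apply: perm_big; apply: uniq_perm => //.
  apply: filter_uniq; apply: allpairs_uniq; rewrite ?iota_uniq ?index_enum_uniq//.
  by move=> [s j] [s' j'] _ _ /= [-> /addrI/oppr_inj [->]].
move=> u; rewrite mem_filter lE -[u \in parents _ _ _]/(parents p Phi (i, t) u).
apply: andb_idr => /and3P[] /= ut lagp _.
apply/allpairsP; exists (lag u (i, t), u.1); split => //=.
- by rewrite mem_index_iota ltnS lagp andbT /lag absz_gt0 subr_eq0 gt_eqF.
- by rewrite mem_index_enum.
by case: u ut {lagp} => j s /= st; rewrite /lag /=; congr (_, _); lia.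
Qed.

Lemma VAR_regression t i l : lists l (parents p Phi (i, t)) ->
  {ae P, forall w, scalar_rv (X t i) w =
    nodes_row X l w *m coef_col Phi (i, t) l + scalar_rv (eps t i) w}.
Proof.
move=> hl; apply: filterS (VAR_eq hVAR t i) => w Xe.
apply/matrixP => a b; rewrite !ord1 [RHS]mxE nodes_row_coef [LHS]mxE Xe.
by rewrite -(lag_sum_parents (fun u => X u.2 u.1 w) hl) mxE eqxx !mulr1n.
Qed.

End VAR.

(** * Calculus of partial covariances *)

Section partial_covariance_calculus.
Context d (T : measurableType d) (R : realType) (P : probability T R).
Variables (m : nat) (U : T -> 'rV[R]_m).
Hypotheses (U2 : L2_row P U) (Gu : moment P U U \in unitmx).
Local Notation pcov := (pcov P U).

Lemma pcov_tr k n (V : T -> 'rV[R]_k) (V' : T -> 'rV[R]_n) :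
  (pcov V V')^T = pcov V' V.
Proof.
rewrite /pcov linearB /= !trmx_mul trmx_inv !moment_tr mulmxA.
by [].
Qed.

Lemma pcovDr k n (V : T -> 'rV[R]_k) (V1 V2 : T -> 'rV[R]_n) :
  L2_row P V -> L2_row P V1 -> L2_row P V2 ->
  pcov V (fun w => V1 w + V2 w) = pcov V V1 + pcov V V2.
Proof.
move=> V_2 V1_2 V2_2; rewrite /pcov !momentDr// mulmxDr opprD.
exact: addrACA.
Qed.

Lemma pcovMr k n l (V : T -> 'rV[R]_k) (V' : T -> 'rV[R]_n) (M : 'M[R]_(n, l)) :
  L2_row P V -> L2_row P V' ->
  pcov V (fun w => V' w *m M) = pcov V V' *m M.
Proof. by move=> V2 V'2; rewrite /pcov !moment_mulmxr// mulmxBl !mulmxA. Qed.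

Lemma pcov_regressor k n (V : T -> 'rV[R]_k) (C : 'M[R]_(m, n)) :
  L2_row P V -> pcov V (fun w => U w *m C) = 0.
Proof. by move=> V2; rewrite pcovMr// /pcov mulmxKV// subrr mul0mx. Qed.

(** The terms of a regression equation that are linear in the regressors can be
dropped. *)
Lemma pcov_aer k n (V : T -> 'rV[R]_k) (V1 V2 : T -> 'rV[R]_n) (C : 'M[R]_(m, n)) :
  L2_row P V -> L2_row P V1 -> L2_row P V2 ->
  {ae P, forall w, V1 w = V2 w + U w *m C} -> pcov V V1 = pcov V V2.
Proof.
move=> V_2 V1_2 V2_2 V12.
have UC2 := L2_row_mulmx C U2.
have V2UC2 := L2_rowD V2_2 UC2.
rewrite /pcov (moment_aer V_2 V1_2 V2UC2 V12) (moment_aer U2 V1_2 V2UC2 V12).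
by rewrite -[LHS]/(pcov V _) pcovDr// pcov_regressor// addr0.
Qed.

Lemma pcov_orthr k n (V : T -> 'rV[R]_k) (V' : T -> 'rV[R]_n) :
  moment P V V' = 0 -> moment P U V' = 0 -> pcov V V' = 0.
Proof. by rewrite /pcov => -> ->; rewrite mulmx0 subrr. Qed.

End partial_covariance_calculus.

(** As e is orthogonal to Z, the vector E[U^T e] is (E[W^T e], 0), and it meets
only the upper left block of the inverse Gram matrix. *)
Lemma pcov_schur d (T : measurableType d) (R : realType) (P : probability T R)
    m n k (W : T -> 'rV[R]_m) (Z : T -> 'rV[R]_n) (e : T -> 'rV[R]_k) :
  L2_row P W -> L2_row P Z ->
  moment P (row_mx_rv W Z) (row_mx_rv W Z) \in unitmx ->
  moment P Z e = 0 ->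
  let SZ := moment P W W - moment P W Z *m invmx (moment P Z Z) *m moment P Z W in
  SZ \in unitmx /\
  pcov P (row_mx_rv W Z) e e =
    moment P e e - moment P e W *m invmx SZ *m moment P W e.
Proof.
move=> W2 Z2 Gu Ze SZ; have Zu := gram_minor_unitmx W2 Z2 Gu.
have GE : moment P (row_mx_rv W Z) (row_mx_rv W Z) =
    block_mx (moment P W W) (moment P W Z) (moment P Z W) (moment P Z Z).
  by rewrite moment_row_mxl !moment_row_mxr.
have [Su ulE] := invmx_block_ul Zu (eq_ind _ (fun M => M \in unitmx) Gu _ GE).
split=> //; rewrite /pcov GE moment_row_mxl moment_row_mxr Ze.
rewrite -[moment P e Z]moment_tr Ze trmx0 -[invmx (block_mx _ _ _ _)]submxK ulE.
by rewrite mul_row_block mul_row_col !mul0mx !addr0 mulmx0 addr0.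
Qed.

(** * Regression on the parents *)

Section VAR_parents.
Context d (T : measurableType d) (R : realType) (P : probability T R).
Variables (N p : nat) (Phi : nat -> 'M[R]_N) (Sigma : 'M[R]_N).
Variables X eps : int -> 'I_N -> {RV P >-> R}.
Hypothesis hVAR : gaussian_VAR p Phi Sigma X eps.

Lemma moment_component_innovation u t i : u.2 < t ->
  moment P (scalar_rv (X u.2 u.1)) (scalar_rv (eps t i)) = 0.
Proof.
move=> ut; rewrite (_ : scalar_rv _ = nodes_row X [:: u]).
  by apply: (moment_past_innovation hVAR (l := [:: u])) => v; rewrite inE => /eqP ->.
by apply/funext => w; apply/rowP => j; rewrite !ord1 !mxE eqxx mulr1n.
Qed.

(** The earlier innovation is X_s minus a combination of its parents, all of
which precede the later innovation. *)
Lemma moment_innovations s t i j l : s < t ->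
  lists l (parents p Phi (i, s)) ->
  moment P (scalar_rv (eps s i)) (scalar_rv (eps t j)) = 0.
Proof.
move=> st hl.
have X2 := L2_row_scalar (VAR_L2 hVAR s i).
have e2 u k := L2_row_scalar (innovation_L2 hVAR u k).
have Z2 : L2_row P (nodes_row X l) by exact: (L2_nodes_row hVAR).
have ZA2 := L2_row_mulmx (coef_col Phi (i, s) l) Z2.
have eE : {ae P, forall w, scalar_rv (eps s i) w =
    scalar_rv (X s i) w - nodes_row X l w *m coef_col Phi (i, s) l}.
  by apply: filterS (VAR_regression hVAR hl) => w ->; rewrite addrAC subrr add0r.
rewrite (moment_ael (e2 t j) (e2 s i) (L2_rowB X2 ZA2) eE).
rewrite momentBl// moment_mulmxl// (moment_past_innovation hVAR).
  by rewrite (@moment_component_innovation (i, s))// mulmx0 subr0.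
by move=> u; rewrite hl.2 => /and3P[+ _ _] => /lt_trans; apply.
Qed.

(** The parent u is split off from the regressors to exhibit its coefficient. *)
Lemma VAR_regression_cons t i u l : u \notin l ->
  lists l [pred v | parents p Phi (i, t) v & v != u] -> link p Phi u (i, t) ->
  {ae P, forall w, scalar_rv (X t i) w =
    Phi (lag u (i, t)) i u.1 *: scalar_rv (X u.2 u.1) w +
    nodes_row X l w *m coef_col Phi (i, t) l + scalar_rv (eps t i) w}.
Proof.
move=> ul [l_uniq lE] lu.
have hul : lists (u :: l) (parents p Phi (i, t)).
  split; first by rewrite /= ul.
  move=> v; rewrite inE lE !inE; have [->|] := eqVneq v u; last by rewrite andbT.
  by [].
apply: filterS (VAR_regression hVAR hul) => w ->; congr (_ + _).
apply/matrixP => a b; rewrite !ord1 nodes_row_coef big_cons [RHS]mxE nodes_row_coef.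
by rewrite !mxE eqxx mulr1n mulrC.
Qed.

End VAR_parents.

Theorem theorem1 (d : measure_display) (T : measurableType d) (R : realType)
    (P : probability T R) (N p : nat) (Phi : nat -> 'M[R]_N) (Sigma : 'M[R]_N)
    (X eps : int -> 'I_N -> {RV P >-> R})
    (hVAR : gaussian_VAR p Phi Sigma X eps)
    (x y : 'I_N) (tau : nat) (htau : (0 < tau)%N) (t : int)
    (hlink : link p Phi (x, t - tau%:Z) (y, t))
    (zs ws : seq (node N))
    (hzs : lists zs (parents p Phi (x, t - tau%:Z)))
    (hws : lists ws [pred u | parents p Phi (y, t) u & u != (x, t - tau%:Z)]) :
  let c := Phi tau y x in
  let Xv := scalar_rv (X (t - tau%:Z) x) in
  let Yv := scalar_rv (X t y) in
  let epsX := scalar_rv (eps (t - tau%:Z) x) in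
  let epsY := scalar_rv (eps t y) in
  let Z := nodes_row X zs in
  let W := nodes_row X ws in
  let A := coef_col Phi (x, t - tau%:Z) zs in
  let B := coef_col Phi (y, t) ws in
  let U := row_mx_rv W Z in
  let XU := project_out P Xv U in
  let YU := project_out P Yv U in
  let SZ := moment P W W - moment P W Z *m invmx (moment P Z Z) *m moment P Z W in
  let rhoMIT := partial_correlation P (X (t - tau%:Z) x) (X t y) U in
  moment P U U \in unitmx ->
  [/\ {ae P, forall w, Xv w = Z w *m A + epsX w} /\
      {ae P, forall w, Yv w = c *: Xv w + W w *m B + epsY w},
      moment P Z Z \in unitmx /\ SZ \in unitmx,
      rhoMIT = moment P YU XU 0 0 /
        (Num.sqrt (moment P YU YU 0 0) * Num.sqrt (moment P XU XU 0 0)) &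
      [/\ moment P YU XU = (c * Sigma x x)%:M
            - c *: (moment P epsX W *m invmx SZ *m moment P W epsX),
          moment P YU YU = (Sigma y y + c ^+ 2 * Sigma x x)%:M
            - c ^+ 2 *: (moment P epsX W *m invmx SZ *m moment P W epsX) &
          moment P XU XU = (Sigma x x)%:M
            - moment P epsX W *m invmx SZ *m moment P W epsX]].

Proof.
move=> c Xv Yv epsX epsY Z W A B U XU YU SZ rhoMIT Gu.
pose s := t - tau%:Z.
have st : s < t by rewrite gtrBl ltz_nat.
have zs_past u : u \in zs -> u.2 < s by rewrite hzs.2 => /and3P[].
have ws_past u : u \in ws -> u.2 < t by rewrite hws.2 inE => /andP[/and3P[]].
have lagE : lag (x, s) (y, t) = tau by rewrite /lag /= opprB addrC subrK absz_nat.
have X2 : L2_row P Xv by exact: L2_row_scalar (VAR_L2 hVAR _ _).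
have Y2 : L2_row P Yv by exact: L2_row_scalar (VAR_L2 hVAR _ _).
have eX2 : L2_row P epsX by exact: L2_row_scalar (innovation_L2 hVAR _ _).
have eY2 : L2_row P epsY by exact: L2_row_scalar (innovation_L2 hVAR _ _).
have Z2 : L2_row P Z by exact: (L2_nodes_row hVAR).
have W2 : L2_row P W by exact: (L2_nodes_row hVAR).
have U2 : L2_row P U by exact: L2_row_mx.
have Xreg : {ae P, forall w, Xv w = Z w *m A + epsX w}.
  exact: (VAR_regression hVAR hzs).
have Yreg : {ae P, forall w, Yv w = c *: Xv w + W w *m B + epsY w}.
  have := VAR_regression_cons hVAR _ hws hlink; rewrite lagE; apply.
  by rewrite hws.2 inE eqxx andbF.
have ZeX : moment P Z epsX = 0 by exact: (moment_past_innovation hVAR).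
have UeY : moment P U epsY = 0.
  rewrite moment_row_mxl !(moment_past_innovation hVAR) ?col_mx0//.
  by move=> u /zs_past /lt_trans; apply.
have eXeY : moment P epsX epsY = 0 by exact: (moment_innovations hVAR _ st hzs).
(* what remains of Y modulo the span of (W, Z) *)
pose D w := epsX w *m c%:M + epsY w.
have D2 : L2_row P D by apply: L2_rowD => //; exact: L2_row_mulmx.
have XE : {ae P, forall w, Xv w = epsX w + U w *m col_mx 0 A}.
  by apply: filterS Xreg => w ->; rewrite mul_row_col mulmx0 add0r addrC.
have YE : {ae P, forall w, Yv w = D w + U w *m col_mx B (c *: A)}.
  apply: filterS2 Xreg Yreg => w Xw ->; rewrite Xw mul_row_col /D.
  rewrite mul_mx_scalar scalerDr -scalemxAr.
  by rewrite [LHS](ACl (2*4*(3*1))).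
pose K := pcov P U epsX epsX.
have [SZu KE] : SZ \in unitmx /\ K = moment P epsX epsX
    - moment P epsX W *m invmx SZ *m moment P W epsX.
  exact: pcov_schur.
have {}KE : K = (Sigma x x)%:M - moment P epsX W *m invmx SZ *m moment P W epsX.
  by rewrite KE (moment_innovation hVAR).
have pXX : pcov P U Xv Xv = K.
  rewrite (pcov_aer U2 Gu X2 X2 eX2 XE) -pcov_tr.
  by rewrite (pcov_aer U2 Gu eX2 X2 eX2 XE) pcov_tr.
have pYD V : L2_row P V -> pcov P U V Yv = pcov P U V D.
  by move=> V2; exact: (pcov_aer U2 Gu V2 Y2 D2 YE).
have pD V : L2_row P V -> pcov P U V D = c *: pcov P U V epsX + pcov P U V epsY.
  move=> V2; rewrite pcovDr ?pcovMr ?mul_mx_scalar//.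
  exact: L2_row_mulmx.
have pXY : pcov P U epsX D = c *: K.
  by rewrite pD// (pcov_orthr eXeY UeY) addr0.
have pDX : pcov P U D epsX = c *: K by rewrite -pcov_tr pXY linearZ /= pcov_tr.
have pYX : pcov P U Yv Xv = c *: K.
  by rewrite (pcov_aer U2 Gu Y2 X2 eX2 XE) -pcov_tr pYD// pcov_tr.
have pDeY : pcov P U D epsY = (Sigma y y)%:M.
  rewrite -pcov_tr pD// linearD linearZ /= !pcov_tr (pcov_orthr eXeY UeY).
  by rewrite scaler0 add0r /pcov UeY mulmx0 subr0 (moment_innovation hVAR).
have pYY : pcov P U Yv Yv = (Sigma y y)%:M + c ^+ 2 *: K.
  by rewrite pYD// -pcov_tr pYD// pcov_tr pD// pDX pDeY scalerA addrC.
split=> //.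
- by split=> //; exact: gram_minor_unitmx W2 Z2 Gu.
- have U0 : moment P (fun _ => 1%:M : 'rV[R]_1) U = 0.
    by rewrite moment_row_mxr !(nodes_row_centered hVAR) row_mx0.
  have pXYtr : moment P XU YU = moment P YU XU.
    by rewrite -moment_tr [moment P YU XU]mx11_scalar tr_scalar_mx.
  rewrite /rhoMIT (partial_correlationE U2 Gu U0 (VAR_L2 hVAR _ _) (VAR_L2 hVAR _ _)).
  + by rewrite pXYtr; congr (_ / _); exact: mulrC.
  + exact: (component_centered hVAR).
  + exact: (component_centered hVAR).
rewrite !moment_project_out// pXX pYX pYY KE; split=> //.
- by rewrite scalerBr scale_scalar_mx.
- by rewrite scalerBr scale_scalar_mx addrA -raddfD.
Qed.
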